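(* Let $(E,\|\cdot\|_E)$ be a Banach space, let $\Phi:E\to\mathbb{R}^+$ be a continuous convex function, let $X_1,\dots,X_n$ be i.i.d. discrete random variables taking a finite number of values, let $X=(X_1,\dots,X_n)$, and let $S=S(X_1,\dots,X_n)$ be a function of $X_1,\dots,X_n$ with values in $E$. For any $\alpha\in(0,1)$, let $\xi_1(\alpha),\dots,\xi_n(\alpha)$ be i.i.d. random variables, independent of $X_1,\dots,X_n$, such that $\mathbb{P}(\xi_i(\alpha)=1)=1-\alpha$ and $\mathbb{P}(\xi_i(\alpha)=-1)=\alpha$, and let $\delta_i(\alpha)=(\xi_i(\alpha)-\mathbb{E}\,\xi_i(\alpha))/\sqrt{\mathrm{Var}\,\xi_i(\alpha)}$. Then $$\mathbb{E}\,\Phi(S-\mathbb{E}S)\le\int_0^1\mathbb{E}\,\Phi\left(\pi\sum_{i=1}^n\delta_i(\alpha)\,d_iS(X)\right)\frac{\mathrm{d}\alpha}{\pi\sqrt{\alpha(1-\alpha)}}.$$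
   Context: For $i\in\{1,\dots,n\}$, $d_iS$ is the function defined by $d_iS(x_1,\dots,x_n):=S(x_1,\dots,x_n)-\mathbb{E}\,S(x_1,\dots,x_{i-1},X_i,x_{i+1},\dots,x_n)$. *)

(* Defs.v *)
From mathcomp Require Export all_boot all_order all_algebra.
From mathcomp Require Export all_classical all_reals all_analysis.
Export numFieldNormedType.Exports.

Set Implicit Arguments.
Unset Strict Implicit.
Unset Printing Implicit Defensive.

Local Open Scope classical_set_scope.
Local Open Scope ring_scope.

Definition mutually_independent (R : realType) (d d' : measure_display)
    (Omega : measurableType d) (T : measurableType d')
    (P : probability Omega R) (n : nat) (X : 'I_n -> {RV P >-> T}) : Prop :=
  forall (J : {set 'I_n}) (A : 'I_n -> set T),
    (forall i, measurable (A i)) ->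
    P (\bigcap_(i in [set` J]) (X i @^-1` A i)) =
    (\prod_(i in J) P (X i @^-1` A i))%E.
Arguments mutually_independent {R d d' Omega T} P {n} X.

Definition identically_distributed (R : realType) (d d' : measure_display)
    (Omega : measurableType d) (T : measurableType d')
    (P : probability Omega R) (n : nat) (X : 'I_n -> {RV P >-> T}) : Prop :=
  forall (i j : 'I_n) (A : set T), measurable A ->
    distribution P (X i) A = distribution P (X j) A.
Arguments identically_distributed {R d d' Omega T} P {n} X.

Definition iid (R : realType) (d d' : measure_display)
    (Omega : measurableType d) (T : measurableType d')
    (P : probability Omega R) (n : nat) (X : 'I_n -> {RV P >-> T}) : Prop :=
  mutually_independent P X /\ identically_distributed P X.
Arguments iid {R d d' Omega T} P {n} X.

(* The random vectors (X_1, ..., X_m) and (Y_1, ..., Y_n) are independent, i.e.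
   the sigma-algebras they generate are. *)
Definition independent_vectors (R : realType) (d d1 d2 : measure_display)
    (Omega : measurableType d) (T1 : measurableType d1)
    (T2 : measurableType d2) (P : probability Omega R) (m n : nat)
    (X : 'I_m -> {RV P >-> T1}) (Y : 'I_n -> {RV P >-> T2}) : Prop :=
  forall A B : set Omega,
    g_sigma_preimage (fun i => X i : Omega -> T1) A ->
    g_sigma_preimage (fun i => Y i : Omega -> T2) B ->
    P (A `&` B) = (P A * P B)%E.
Arguments independent_vectors {R d d1 d2 Omega T1 T2} P {m n} X Y.

(* Expectation of a vector-valued function Y taking finitely many values, each
   on a measurable set: the integral of a simple function (a junk value for
   other Y). *)
Definition simple_expectation (R : realType) (d : measure_display)
    (Omega : measurableType d) (P : probability Omega R)
    (E : normedModType R) (Y : Omega -> E) : E :=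
  \sum_(y \in range Y) fine (P (Y @^-1` [set y])) *: y.
Arguments simple_expectation {R d Omega} P {E} Y.

Definition centered_diff (R : realType) (d d' : measure_display)
    (Omega : measurableType d) (T : measurableType d')
    (P : probability Omega R) (E : normedModType R) (n : nat)
    (X : 'I_n -> {RV P >-> T}) (S : ('I_n -> T) -> E) (i : 'I_n)
    (x : 'I_n -> T) : E :=
  S x - simple_expectation P
          (fun w => S (fun j => if j == i then X i w else x j)).
Arguments centered_diff {R d d' Omega T} P {E n} X S i x.

Definition standardize (R : realType) (d : measure_display)
    (Omega : measurableType d) (P : probability Omega R)
    (xi : {RV P >-> R}) (w : Omega) : R :=
  (xi w - fine 'E_P[xi]) / Num.sqrt (fine 'V_P[xi]).
Arguments standardize {R d Omega} P xi w.

(* Main.v *)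
(** Replace each [X_i], independently with probability [a], by an independent
    copy, and let [Q_a S (x)] be the conditional mean of [S] at the resampled
    point given [X = x], so that [Q_0 S = S] and [Q_1 S] is the constant [E S].
    If [xi_i = 1] records that [X_i] was kept, then differentiating the law of
    the signs brings out its score [- sum_i delta_i / sqrt (a (1 - a))], whence
      [S - E S = int_0^1 E (pi sum_i delta_i d_i S (X^a) | X)
                   da / (pi sqrt (a (1 - a)))]
    where [X^a] is the resampled point; in the i-th term [S] may be replaced by
    [d_i S] because the difference does not depend on the i-th coordinate and [delta_i] is
    centered. Jensen's inequality, for the arcsine probability measure and for
    the conditional expectation, concludes, since [(delta, X^a)] and [(delta, X)]
    have the same law. Jensen's inequality is applied through a supporting
    affine function of [Phi] at [S (x) - E S], so only scalar functions of [a]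
    have to be integrated. *)

From HB Require Import structures.
Require Import Defs.
From mathcomp Require Import measurable_realfun lra ring.
Import Order.TTheory GRing.Theory Num.Theory.

Set Implicit Arguments.
Unset Strict Implicit.
Unset Printing Implicit Defensive.

Local Open Scope classical_set_scope.
Local Open Scope ring_scope.

(** * Supporting affine functions *)

Definition convexf (R : realType) (E : lmodType R) (p : E -> R) : Prop :=
  forall (t : R) (x y : E), 0 <= t <= 1 ->
    p (t *: x + (1 - t) *: y) <= t * p x + (1 - t) * p y.

Section linear_minorant.
Context (R : realType) (E : lmodType R).
Implicit Types (p q : E -> R) (u v x y : E).

(** Near-minimizers [i] at [x] and [j] at [y] are merged into one index [k], at the cost of the
    error [e] only. The merging hypothesis covers a chain, where [k] is the smaller of the two, and
    a family of translates, where [k] is a convex combination of the parameters. *)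
Lemma inf_convexf (I : Type) (i0 : I) (F : I -> E -> R) :
  (forall x, exists m, forall i, m <= F i x) ->
  (forall i j x y t, 0 <= t <= 1 -> exists k,
      F k (t *: x + (1 - t) *: y) <= t * F i x + (1 - t) * F j y) ->
  convexf (fun x => inf (range (F ^~ x))).
Proof.
move=> lbF dirF t x y t01.
have infF z : has_inf (range (F ^~ z)).
  split; first by exists (F i0 z); exists i0.
  by have [m mF] := lbF z; exists m => _ [i _ <-].
apply/ler_addgt0Pl => e e0.
have [_ [i _ <-] Fi] := inf_adherent e0 (infF x).
have [_ [j _ <-] Fj] := inf_adherent e0 (infF y).
have [k Fk] := dirF i j x y t t01.
apply: (le_trans (ge_inf (infF _).2 _)); first by exists k.
apply: (le_trans Fk); move: t01 Fi Fj => /andP[].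
set a := inf _; set b := inf _; move: (F i x) (F j y) => f g t0 t1 fa gb.
have : t * (f - a - e) <= 0 by rewrite mulr_ge0_le0//; lra.
have : (1 - t) * (g - b - e) <= 0 by rewrite mulr_ge0_le0//; lra.
lra.
Qed.

(** By convexity, every backward difference quotient at 0 is at most every forward one; [a] is the
    supremum of the backward quotients. *)
Lemma convexf_line_subgradient p e : convexf p ->
  exists a, forall t, p 0 + a * t <= p (t *: e).
Proof.
move=> cp.
have slope s t : 0 < s -> 0 < t ->
    (p 0 - p (- t *: e)) / t <= (p (s *: e) - p 0) / s.
  move=> s0 t0; rewrite ler_pdivrMr// mulrAC ler_pdivlMr//.
  have st0 : s + t != 0 by rewrite gt_eqF// addr_gt0.
  have := cp (t / (s + t)) (s *: e) (- t *: e).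
  rewrite !scalerA -scalerDl.
  have -> : t / (s + t) * s + (1 - t / (s + t)) * - t = 0 by field.
  rewrite scale0r => /(_ _)/wrap[].
    apply/andP; split; first by rewrite divr_ge0 ?ltW ?addr_gt0.
    by rewrite ler_pdivrMr ?addr_gt0// mul1r lerDr ltW.
  have -> : t / (s + t) * p (s *: e) + (1 - t / (s + t)) * p (- t *: e) =
     (t * p (s *: e) + s * p (- t *: e)) / (s + t) by field.
  rewrite ler_pdivlMr ?addr_gt0//; lra.
pose A := [set (p 0 - p (- t *: e)) / t | t in [set t | 0 < t]].
have supA : has_sup A.
  split; first by exists ((p 0 - p (- 1 *: e)) / 1); exists 1 => //=.
  by exists ((p (1 *: e) - p 0) / 1) => _ [t /= t0 <-]; exact: slope.
exists (sup A) => t; have [t0|t0|->] := ltgtP t 0; last first.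
- by rewrite scale0r mulr0 addr0.
- rewrite addrC -lerBrDr -ler_pdivlMr//; apply: sup_le_ub; first exact: supA.1.
  by move=> _ [s /= s0 <-]; exact: slope.
- have : (p 0 - p (t *: e)) / - t <= sup A.
    apply: sup_ubound; first exact: supA.2.
    by exists (- t); rewrite /= ?oppr_gt0// opprK.
  rewrite ler_pdivrMr ?oppr_gt0//; lra.
Qed.

Lemma convexf_ge_opp p u : convexf p -> p 0 = 0 -> - p (- u) <= p u.
Proof.
move=> cp p0; have := cp (1 / 2) u (- u).
have -> : (1 - 1 / 2 : R) = 1 / 2 by field.
rewrite scalerN subrr p0 => /(_ _)/wrap[]; last by lra.
by apply/andP; split; lra.
Qed.

(* A minimal element [q] of the set of convex functions that vanish at 0 and
   lie below [p] is linear: with [a] the slope of a supporting line of [q] in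
   the direction [e], the function [u |-> inf_t (q (u + t e) - a t)] belongs to
   this set and lies below [q], hence equals [q]: [q (u + t e) = q u + a t]. *)
Lemma convexf_linear_minorant p : convexf p -> p 0 = 0 ->
  exists l : {scalar E}, forall u, l u <= p u.
Proof.
move=> cp p0.
pose below (q : E -> R) := [/\ convexf q, q 0 = 0 & forall u, q u <= p u].
have below_lb q u : below q -> - p (- u) <= q u.
  case=> cq q0 qp; apply: le_trans (convexf_ge_opp u cq q0).
  by rewrite lerN2.
(* The order is reversed, so that a maximal element in Zorn's lemma is a minimal function. *)
pose rel (s t : {q | below q}) := `[< forall u, sval t u <= sval s u >].
have [|||A totA|] := @Zorn {q | below q} rel.
- by move=> t; apply/asboolP.
- move=> r s t /asboolP rs /asboolP st; apply/asboolP => u.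
  exact: le_trans (st u) (rs u).
- move=> [s bs] [t bt] /asboolP/= st /asboolP/= ts.
  apply: eq_exist => /=; apply/funext => u.
  by apply/eqP; rewrite eq_le ts st.
(* The empty chain is bounded by [p] itself, a nonempty one by its pointwise infimum, which is
   finite by [below_lb]. *)
- have [[s0 As0]|nA] := pselect (exists s, A s); last first.
    have bp : below p by split.
    by exists (exist _ p bp) => s As; exfalso; apply: nA; exists s.
  pose I := {s | A s}.
  pose F (i : I) := sval (sval i).
  have bF i : below (F i) by rewrite /F; case: i => -[].
  have lbF x : has_lbound (range (F ^~ x)).
    by exists (- p (- x)) => _ [i _ <-]; exact: below_lb.
  pose q x := inf (range (F ^~ x)).
  have i0 : I by exists s0.
  have qF x i : q x <= F i x by apply: (ge_inf (lbF x)); exists i.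
  have bq : below q.
    split.
    + apply: (inf_convexf i0).
        by move=> x; exists (- p (- x)) => i; exact: below_lb.
      move=> i j x y t /andP[t0 t1].
      have [ij|ji] : (forall u, F i u <= F j u) \/ (forall u, F j u <= F i u).
        case: i j => [i Ai] [j Aj]; rewrite /F/=.
        by case: (totA i j Ai Aj) => /asboolP; [right|left].
      * exists i; have [+ _ _] := bF i => /(_ t x y)/(_ _)/wrap[].
          by rewrite t0.
        by move/le_trans; apply; rewrite lerD2l ler_wpM2l ?subr_ge0.
      * exists j; have [+ _ _] := bF j => /(_ t x y)/(_ _)/wrap[].
          by rewrite t0.
        by move/le_trans; apply; rewrite lerD2r ler_wpM2l.
    + rewrite /q [X in inf X](_ : _ = [set 0]) ?inf1//.
      apply/seteqP; split => [_ [i _ <-]|_ ->]; first by have [_ ->] := bF i.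
      by exists i0 => //; have [_ ->] := bF i0.
    + by move=> u; apply: (le_trans (qF u i0)); have [_ _] := bF i0.
  exists (exist _ q bq) => s As; apply/asboolP => u /=.
  exact: (qF u (exist _ s As)).
move=> [q bq] qmin; have [cq q0 qp] := bq.
have qline e : exists a, forall u t, q (u + t *: e) = q u + a * t.
  have [a qa] := convexf_line_subgradient e cq.
  exists a.
  pose F (t : R) u := q (u + t *: e) - a * t.
  have lbF u : exists m, forall t, m <= F t u.
    exists (- q (- u)) => t; rewrite /F.
    (* The midpoint of these two points lies on the line spanned by [e], where the supporting line
       bounds [q] from below. *)
    have := cq (1 / 2) (u + t *: e) (- u).
    have -> : (1 - 1 / 2 : R) = 1 / 2 by field.
    rewrite -scalerDr addrAC subrr add0r scalerA => /(_ _)/wrap[].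
      by apply/andP; split; lra.
    have := qa (1 / 2 * t); rewrite q0; lra.
  have F1 u t : inf (range (F ^~ u)) <= F t u.
    apply: ge_inf; last by exists t.
    by have [m mF] := lbF u; exists m => _ [i _ <-].
  have F0 u : inf (range (F ^~ u)) <= q u.
    by have := F1 u 0; rewrite {2}/F scale0r addr0 mulr0 subr0.
  have bF : below (fun u => inf (range (F ^~ u))).
    split.
    - apply: (inf_convexf 0) => // s r x y t t01.
      exists (t * s + (1 - t) * r); rewrite /F.
      have := cq t (x + s *: e) (y + r *: e) t01.
      rewrite !scalerDr !scalerA addrACA -scalerDl; lra.
    - apply/eqP; rewrite eq_le; apply/andP; split; first by rewrite -[leRHS]q0.
      apply: lb_le_inf; first by exists (F 0 0); exists 0.
      by move=> _ [t _ <-]; rewrite /F add0r subr_ge0; have := qa t; rewrite q0 add0r.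
    - by move=> u; exact: le_trans (F0 u) (qp u).
  have /(congr1 sval)/= eqF : exist _ _ bF = exist _ q bq.
    by apply: qmin; apply/asboolP.
  have qle u t : q u <= F t u by rewrite -[in leLHS]eqF.
  move=> u t; have := qle u t; have := qle (u + t *: e) (- t).
  rewrite /F -addrA -scalerDl subrr scale0r addr0.
  by move=> h1 h2; apply/eqP; rewrite eq_le; apply/andP; split; lra.
have qlin : scalar q.
  move=> a u v; have [b qb] := qline u.
  have qu : q u = b by rewrite -[u in LHS]scale1r -[X in q X]add0r qb q0 add0r mulr1.
  by rewrite [a *: u + v]addrC qb /= qu addrC mulrC.
pose l : {scalar E} := HB.pack_for {scalar E} q
  (GRing.isLinear.Build R E R *%R q qlin).
by exists l.
Qed.

Lemma convexf_subgradient p u : convexf p ->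
  exists l : {scalar E}, forall v, p u + l (v - u) <= p v.
Proof.
move=> cp.
have [||l lp] := @convexf_linear_minorant (fun v => p (u + v) - p u).
- move=> t x y t01.
  have -> : u + (t *: x + (1 - t) *: y) = t *: (u + x) + (1 - t) *: (u + y).
    by rewrite !scalerDr addrACA -scalerDl subrKC scale1r.
  have := cp t (u + x) (u + y) t01; lra.
- by rewrite addr0 subrr.
- exists l => v; have := lp (v - u); rewrite subrKC; lra.
Qed.

End linear_minorant.

(** * Resampling *)

(* A sign is encoded by a boolean, [true] standing for 1 and [false] for -1. *)
Definition bool_weight (R : realType) (a : R) (b : bool) : R :=
  if b then 1 - a else a.

(** This is the standardized sign, as [bool_stdE] shows, written as [- Num.sqrt (a * (1 - a))] times
    the logarithmic derivative in [a] of [bool_weight a b]. *)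
Definition bool_std (R : realType) (a : R) (b : bool) : R :=
  Num.sqrt (a * (1 - a)) * (if b then (1 - a)^-1 else - a^-1).

Definition mix (n : nat) (V : finType) (e : {ffun 'I_n -> bool})
  (x y : {ffun 'I_n -> V}) : {ffun 'I_n -> V} :=
  [ffun i => if e i then x i else y i].

Definition prod_weight (R : realType) (n : nat) (V : finType)
  (p : 'I_n -> V -> R) (x : {ffun 'I_n -> V}) : R := \prod_i p i (x i).

Lemma is_derive_bigsum (R : realType) (I : Type) (s : seq I) (h : I -> R -> R)
    (dh : I -> R) (a : R) : (forall i, is_derive a 1 (h i) (dh i)) ->
  is_derive a 1 (fun b => \sum_(i <- s) h i b) (\sum_(i <- s) dh i).
Proof.
move=> hdh; elim: s => [|i s IH].
  rewrite (_ : (fun _ => _) = cst 0); last by apply/funext => b; rewrite big_nil.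
  by rewrite big_nil; exact: is_derive_cst.
rewrite (_ : (fun _ => _) = (fun b => h i b + \sum_(i <- s) h i b)); last first.
  by apply/funext => b; rewrite big_cons.
by rewrite big_cons; exact: is_deriveD.
Qed.

Section mixing.
Context (R : realType) (n : nat) (V : finType) (p : 'I_n -> V -> R).
Hypothesis p_sum1 : forall i, \sum_k p i k = 1.
Hypothesis p_ge0 : forall i k, 0 <= p i k.
Local Notation pr := (prod_weight p).
Local Notation qr a := (@prod_weight R n bool (fun=> bool_weight a)).
Local Notation dl := (@bool_std R).
Implicit Types (e : {ffun 'I_n -> bool}) (x y z : {ffun 'I_n -> V}).

Lemma prod_weight_sum1 : \sum_x pr x = 1.
Proof. by rewrite -bigA_distr_bigA big1. Qed.

Lemma prod_weight_ge0 x : 0 <= pr x.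
Proof. exact: prodr_ge0. Qed.

Lemma sum_bool_weight (a : R) : \sum_b bool_weight a b = 1.
Proof. by rewrite big_bool/= subrK. Qed.

(* [(x, y) |-> (mix e x y, mix e y x)] is an involution which preserves the
   weight [pr x * pr y]. *)
Lemma sum_mix e (G : {ffun 'I_n -> V} -> R) :
  \sum_x \sum_y pr x * pr y * G (mix e x y) = \sum_x pr x * G x.
Proof.
pose h (u : {ffun 'I_n -> V} * {ffun 'I_n -> V}) :=
  (mix e u.1 u.2, mix e u.2 u.1).
have hK : involutive h.
  by move=> [x y]; rewrite /h/=; congr pair; apply/ffunP => i; rewrite !ffunE; case: (e i).
have prh x y : pr (mix e x y) * pr (mix e y x) = pr x * pr y.
  rewrite /prod_weight -!big_split/=; apply: eq_bigr => i _; rewrite !ffunE.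
  by case: (e i) => //; rewrite mulrC.
rewrite pair_big/= (reindex_inj (inv_inj hK))/=.
transitivity (\sum_u pr u.1 * pr u.2 * G u.1).
  apply: eq_bigr => -[x y] _ /=; rewrite prh; congr (_ * G _).
  by apply/ffunP => i; rewrite !ffunE; case: (e i).
rewrite -(pair_big xpredT xpredT (fun x y => pr x * pr y * G x))/=.
apply: eq_bigr => x _; rewrite -mulr_suml -mulr_sumr prod_weight_sum1.
by rewrite mulr1.
Qed.

(** Flipping the i-th sign is an involution that preserves [r] and negates
    [bool_weight a (e i) * bool_std a (e i)], which is plus or minus [Num.sqrt (a * (1 - a))]. Hence
    the sum equals its opposite. *)
Lemma sum_bool_std_eq0 (a : R) (i : 'I_n) (r : {ffun 'I_n -> bool} -> R) :
  0 < a < 1 ->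
  (forall e e', (forall j, j != i -> e j = e' j) -> r e = r e') ->
  \sum_e qr a e * (dl a (e i) * r e) = 0.
Proof.
move=> /andP[a0 a1] ri.
pose flip e : {ffun 'I_n -> bool} := [ffun j => if j == i then ~~ e j else e j].
have flipK : involutive flip.
  move=> e; apply/ffunP => j; rewrite !ffunE.
  by case: eqP => // _; rewrite negbK.
set s := LHS; suff : s = - s by lra.
rewrite {1}/s (reindex_inj (inv_inj flipK))/= -sumrN; apply: eq_bigr => e _.
have -> : r (flip e) = r e by apply: ri => j /negbTE ji; rewrite ffunE ji.
rewrite !mulrA -mulNr; congr (_ * _).
rewrite /prod_weight (bigD1 i)//= [in RHS](bigD1 i)//= !ffunE eqxx.
rewrite (eq_bigr (fun j => bool_weight a (e j))); last first.
  by move=> j /negbTE ji; rewrite ffunE ji.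
have a1' : 1 - a != 0 by rewrite subr_eq0 gt_eqF.
have a0' : a != 0 by rewrite gt_eqF.
by rewrite /bool_std/bool_weight; case: (e i) => /=; field; rewrite ?a0' ?a1'.
Qed.

(* The derivative in [a] brings out the score function of the law [qr a], and
   the score of one sign is proportional to its standardization. *)
Lemma is_derive_sum_bool (a : R) (r : {ffun 'I_n -> bool} -> R) : 0 < a < 1 ->
  is_derive a 1 (fun a => \sum_e qr a e * r e)
   (- (Num.sqrt (a * (1 - a)))^-1 *
      \sum_e qr a e * ((\sum_i dl a (e i)) * r e)).
Proof.
move=> /andP[a0 a1].
have a1' : 1 - a != 0 by rewrite subr_eq0 gt_eqF.
have a0' : a != 0 by rewrite gt_eqF.
have sa : Num.sqrt (a * (1 - a)) != 0.
  by rewrite gt_eqF// sqrtr_gt0 mulr_gt0// subr_gt0.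
have db b : is_derive a 1 (fun a => bool_weight a b)
    (bool_weight a b * (- (Num.sqrt (a * (1 - a)))^-1 * dl a b)).
  have -> : - (Num.sqrt (a * (1 - a)))^-1 * dl a b = - (if b then (1 - a)^-1 else - a^-1).
    by rewrite /bool_std mulrA mulNr mulVf// mulN1r.
  rewrite /bool_weight.
  case: b; last first.
    by apply: is_derive_eq; rewrite opprK mulfV.
  by apply: is_derive_eq; rewrite add0r mul1r mulrN mulfV.
have dq e (s : seq 'I_n) :
    is_derive a 1 (fun a => \prod_(i <- s) bool_weight a (e i))
     ((\prod_(i <- s) bool_weight a (e i)) * (- (Num.sqrt (a * (1 - a)))^-1 *
       \sum_(i <- s) dl a (e i))).
  elim: s => [|i s IH].
    rewrite (_ : (fun _ => _) = cst 1); last by apply/funext => b; rewrite big_nil.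
    by rewrite !big_nil !mulr0; exact: is_derive_cst.
  rewrite (_ : (fun _ => _) = (fun b => bool_weight b (e i) *
    \prod_(i <- s) bool_weight b (e i))); last by apply/funext => b; rewrite big_cons.
  rewrite !big_cons; apply: (is_derive_eq (is_deriveM (db (e i)) IH)).
  by rewrite /GRing.scale/=; ring.
rewrite mulr_sumr.
have h e : is_derive a 1 (fun a => qr a e * r e)
  (- (Num.sqrt (a * (1 - a)))^-1 * (qr a e * ((\sum_i dl a (e i)) * r e))).
  have := dq e (index_enum 'I_n) => dqe.
  apply: (is_derive_eq (is_deriveM dqe (is_derive_cst (r e) a 1))).
  by rewrite /GRing.scale/= /prod_weight; ring.
exact: is_derive_bigsum.
Qed.

(** Jensen's inequality for the resampled point: [sum_mix] replaces the point on the right by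
    [mix e x y], and there [Phi] is bounded below by the affine function attached to the original
    point [x]. In the application [H i] is the mean of [S] over the i-th coordinate. *)
Lemma weighted_convex_ge (E : lmodType R) (Phi : E -> R)
    (l : {ffun 'I_n -> V} -> {scalar E}) (c : {ffun 'I_n -> V} -> R)
    (S : {ffun 'I_n -> V} -> E) (H : 'I_n -> {ffun 'I_n -> V} -> E) (a : R) :
  (forall x u, c x + l x u <= Phi u) ->
  (forall i x y, (forall j, j != i -> x j = y j) -> H i x = H i y) ->
  0 < a < 1 ->
  \sum_x pr x * (c x + pi * \sum_e qr a e * ((\sum_i dl a (e i)) *
     \sum_y pr y * l x (S (mix e x y)))) <=
  \sum_e qr a e * \sum_x pr x *
     Phi (pi *: \sum_i dl a (e i) *: (S x - H i x)).
Proof.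
move=> lPhi Hi a01; have /andP[a0 a1] := a01.
have qr_ge0 e : 0 <= qr a e.
  by apply: prodr_ge0 => i _; rewrite /bool_weight; case: (e i); rewrite ?subr_ge0 ltW.
have qr_sum1 : \sum_e qr a e = 1.
  by rewrite -bigA_distr_bigA big1// => i _; exact: sum_bool_weight.
pose W e z := pi *: \sum_i dl a (e i) *: (S z - H i z).
have step : \sum_e qr a e * \sum_x \sum_y pr x * pr y * (c x + l x (W e (mix e x y)))
   <= \sum_e qr a e * \sum_x pr x * Phi (W e x).
  apply: ler_sum => e _; rewrite -(sum_mix e) ler_wpM2l//.
  apply: ler_sum => x _; apply: ler_sum => y _.
  by rewrite ler_wpM2l// mulr_ge0// prod_weight_ge0.
apply: le_trans step; rewrite le_eqVlt; apply/orP; left; apply/eqP.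
under [RHS]eq_bigr do rewrite mulr_sumr.
rewrite [RHS]exchange_big/=; apply: eq_bigr => x _.
transitivity (pr x * \sum_e qr a e * \sum_y pr y * (c x + l x (W e (mix e x y)))); last first.
  rewrite mulr_sumr; apply: eq_bigr => e _; rewrite !mulr_sumr.
  by apply: eq_bigr => y _; ring.
congr (_ * _).
transitivity (\sum_e (qr a e * c x + qr a e * \sum_y pr y * l x (W e (mix e x y)))); last first.
  apply: eq_bigr => e _; rewrite -mulrDr; congr (_ * _).
  under [RHS]eq_bigr do rewrite mulrDr.
  by rewrite big_split/= -mulr_suml prod_weight_sum1 mul1r.
rewrite big_split/= -mulr_suml qr_sum1 mul1r; congr (_ + _).
have lW e z : l x (W e z) = pi * ((\sum_i dl a (e i)) * l x (S z)) -
    pi * \sum_i dl a (e i) * l x (H i z).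
  rewrite /W linearZ/= linear_sum/= mulr_suml -mulrBr -sumrB; congr (_ * _).
  by apply: eq_bigr => i _; rewrite linearZ/= linearB/= mulrBr.
(* For fixed [x] and [y], [H i (mix e x y)] does not depend on [e i], so its product with the
   centered [dl a (e i)] averages to 0. *)
under [RHS]eq_bigr do under eq_bigr do rewrite lW mulrBr.
under [RHS]eq_bigr do rewrite sumrB mulrBr.
rewrite sumrB [X in _ = _ - X](_ : _ = 0) ?subr0; last first.
  transitivity (pi * \sum_i \sum_e qr a e * (dl a (e i) * \sum_y pr y * l x (H i (mix e x y)))).
    rewrite exchange_big/= mulr_sumr; apply: eq_bigr => e _.
    rewrite !mulr_sumr.
    under eq_bigr do rewrite !mulr_sumr.
    rewrite exchange_big/=; apply: eq_bigr => i _; rewrite !mulr_sumr.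
    by apply: eq_bigr => y _; ring.
  rewrite big1 ?mulr0// => i _; apply: sum_bool_std_eq0 => // e e' ee'.
  apply: eq_bigr => y _; congr (_ * l x _); apply: Hi => j ji.
  by rewrite !ffunE ee'.
rewrite mulr_sumr; apply: eq_bigr => e _; rewrite mulrCA; congr (_ * _).
by rewrite !mulr_sumr; apply: eq_bigr => y _; ring.
Qed.

End mixing.

Lemma continuous_sqrt_var (R : realType) :
  continuous (fun a : R => Num.sqrt (a * (1 - a))).
Proof.
move=> a; apply: (@continuous_comp R R R (fun a => a * (1 - a)) Num.sqrt).
  by apply: cvgM; [exact: cvg_id|apply: cvgB; [exact: cvg_cst|exact: cvg_id]].
exact: sqrt_continuous.
Qed.

Section signed_sums.
Context (R : realType) (n : nat) (r : {ffun 'I_n -> bool} -> R).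
Local Notation qr a := (@prod_weight R n bool (fun=> bool_weight a)).

(** The endpoints of the interpolation: for [b = true] the parameter is 0 and every coordinate is
    kept; for [b = false] it is 1 and every coordinate is resampled. *)
Lemma sum_bool_degenerate (b : bool) :
  \sum_e qr (~~ b)%:R e * r e = r [ffun=> b].
Proof.
rewrite (bigD1 [ffun=> b])//= [X in X * _]big1 => [|i _]; last first.
  by rewrite ffunE /bool_weight; case: b; rewrite ?subr0.
rewrite mul1r big1 ?addr0// => e eb.
have [i ei] : exists i, e i != b.
  apply/existsP; apply: contraNT eb; rewrite negb_exists => /forallP h.
  by apply/eqP/ffunP => i; rewrite ffunE; apply/eqP; have := h i; rewrite negbK.
rewrite /prod_weight (bigD1 i)//= /bool_weight.
by case: b {eb} (e i) ei => -[]// _; rewrite ?subrr !mul0r.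
Qed.

Lemma continuous_bool_weight (b : bool) : continuous (@bool_weight R ^~ b).
Proof.
move=> a; rewrite /bool_weight; case: b; last exact: cvg_id.
by apply: cvgB; [exact: cvg_cst|exact: cvg_id].
Qed.

Lemma continuous_bool_std (b : bool) (a : R) : 0 < a < 1 ->
  {for a, continuous (@bool_std R ^~ b)}.
Proof.
move=> /andP[a0 a1]; rewrite /bool_std; apply: cvgM.
  exact: continuous_sqrt_var.
case: b; last first.
  by apply: cvgN; apply: cvgV; rewrite ?gt_eqF//; exact: cvg_id.
apply: cvgV; first by rewrite subr_eq0 gt_eqF.
by apply: cvgB; [exact: cvg_cst|exact: cvg_id].
Qed.

Lemma continuous_sum_weight (f : R -> {ffun 'I_n -> bool} -> R) (a : R) :
  (forall e, {for a, continuous (f ^~ e)}) ->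
  {for a, continuous (fun a => \sum_e qr a e * f a e)}.
Proof.
move=> cf; apply: cvg_big => [|e _]; first exact: add_continuous.
apply: cvgM; last exact: cf.
apply: cvg_big => [|i _]; first exact: mul_continuous.
exact: continuous_bool_weight.
Qed.

End signed_sums.

(** * Integration *)

(* No measurability is required: the integral is the difference of the suprema
   of the integrals of the simple functions below the positive and the negative
   parts. *)
Lemma le_integral_pointwise (d : measure_display) (T : measurableType d)
    (R : realType) (mu : {measure set T -> \bar R}) (D : set T)
    (f g : T -> \bar R) :
  (forall x, D x -> f x <= g x)%E ->
  (\int[mu]_(x in D) f x <= \int[mu]_(x in D) g x)%E.
Proof.
move=> fg.
have fgD x : ((f \_ D) x <= (g \_ D) x)%E.
  by rewrite /patch; case: ifPn => //; rewrite inE => /fg.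
rewrite /integral; apply: leeB; apply: le_ereal_sup => _ /= [h hf <-];
  exists h => // x; apply: (le_trans (hf x)).
- by rewrite !funeposE ge_max !le_max lexx orbT andbT fgD.
- by rewrite !funenegE ge_max !le_max lexx orbT andbT leeN2 fgD.
Qed.

(* The endpoints are approached along [a = (1 - cos t) / 2] and [1 - a] as [t]
   tends to 0, because [acos] is only known to be continuous inside its domain. *)
Lemma arcsine_FTC_le (R : realType) (C : R) (B g : R -> R) (F : R -> \bar R) :
  continuous B ->
  (forall a : R, 0 < a < 1 ->
    is_derive a 1 (fun a => C * acos (1 - 2 * a) - B a) (g a)) ->
  (forall a : R, 0 < a < 1 -> {for a, continuous g}) ->
  (forall a : R, 0 < a < 1 -> (0 <= F a)%E) ->
  (forall a : R, 0 < a < 1 -> ((g a)%:E <= F a)%E) ->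
  ((C * pi - (B 1 - B 0))%:E <=
    \int[lebesgue_measure]_(a in `]0%R, 1%R[) F a)%E.
Proof.
move=> cB dA cg F0 gF.
set A := fun a => _ in dA.
set J := (X in (_ <= X)%E).
pose al (t : R) : R := (1 - cos t) / 2.
have calt : continuous al.
  move=> t; apply: cvgM; last exact: cvg_cst.
  by apply: cvgB; [exact: cvg_cst|exact: continuous_cos].
(* The increment of [A] from [al t] to [1 - al t], simplified by [acos (cos t) = t] and
   [acos (- cos t) = pi - t]. *)
pose h (t : R) := C * (pi - 2 * t) - (B (1 - al t) - B (al t)).
have hJ t : 0 < t < pi / 2 -> ((h t)%:E <= J)%E.
  move=> /andP[t0 t2].
  have ct0 : 0 < cos t by apply: cos_gt0_pihalf; rewrite t2 andbT; have := pi_gt0 R; lra.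
  have ct1 : cos t < 1.
    rewrite -[ltRHS]cos0 ltr_cos ?in_itv//=.
      by rewrite lexx ltW// pi_gt0.
    by rewrite (ltW t0)/=; have := pi_gt0 R; lra.
  have a0 : 0 < al t by rewrite /al; lra.
  have ab : al t < 1 - al t by rewrite /al; lra.
  have I01 a : a \in `[al t, 1 - al t] -> 0 < a < 1.
    by rewrite in_itv/= => /andP[? ?]; apply/andP; split; lra.
  have dA' a : a \in `[al t, 1 - al t] -> derivable A a 1.
    by move=> /I01/dA.
  have cA a : a \in `[al t, 1 - al t] -> {for a, continuous A}.
    by move=> /dA' ?; apply: differentiable_continuous; exact/derivable1_diffP.
  have : (\int[lebesgue_measure]_(a in `[al t, (1 - al t)%R]) (g a)%:E =
      (A (1 - al t))%:E - (A (al t))%:E)%E.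
    apply: continuous_FTC2 => //.
    - apply: continuous_in_subspaceT => a; rewrite inE/= => /I01; exact: cg.
    - split.
      + by move=> a aI; apply: dA'; exact: subset_itv_oo_cc aI.
      + by apply: cvg_at_right_filter; apply: cA; rewrite in_itv/= lexx ltW.
      + by apply: cvg_at_left_filter; apply: cA; rewrite in_itv/= lexx ltW.
    - move=> a /subset_itv_oo_cc/I01/dA dAa; rewrite derive1E.
      exact: derive_val.
  have -> : ((A (1 - al t))%:E - (A (al t))%:E)%E = (h t)%:E.
    rewrite -EFinB; congr EFin; rewrite /A /h.
    have -> : 1 - 2 * (1 - al t) = - cos t by rewrite /al; field.
    have -> : 1 - 2 * al t = cos t by rewrite /al; field.
    rewrite acosN ?cosK; first ring.
      by rewrite in_itv/= (ltW t0)/=; have := pi_gt0 R; lra.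
    by rewrite !ltW//; lra.
  move=> <-; rewrite /J [leLHS]integral_mkcond [leRHS]integral_mkcond; apply: le_integral_pointwise => a _.
  rewrite /patch; case: ifPn => [|_].
    by rewrite inE/= => /I01 a01; rewrite ifT ?inE/= ?in_itv//=; exact: gF.
  by case: ifPn => //; rewrite inE/= in_itv/=; exact: F0.
have hc : h t @[t --> 0^'+] --> C * pi - (B 1 - B 0).
  have -> : C * pi - (B 1 - B 0) = h 0.
    rewrite /h /al cos0 subrr mul0r !subr0 mulr0 subr0//.
  apply: cvg_at_right_filter; apply: cvgB.
    apply: cvgM; first exact: cvg_cst.
    apply: cvgB; first exact: cvg_cst.
    by apply: cvgM; [exact: cvg_cst|exact: cvg_id].
  apply: cvgB; last by apply: continuous_comp; [exact: calt|exact: cB].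
  apply: (@continuous_comp _ _ _ (fun t => 1 - al t) B); last exact: cB.
  by apply: cvgB; [exact: cvg_cst|exact: calt].
have pi20 : 0 < pi / 2 :> R by rewrite divr_gt0// pi_gt0.
(* The limit is taken when [J] is real; a single value of [h] rules out minus infinity. *)
case: J hJ => [r| |] hJ.
- rewrite lee_fin; apply: (cvgr_to_le hc).
  near=> t; rewrite -lee_fin; apply: hJ; apply/andP; split => //.
- by rewrite leey.
- have := hJ (pi / 4); rewrite leeNy_eq => /(_ _)/wrap[] //.
  by apply/andP; split; have := pi_gt0 R; lra.
Unshelve. all: by end_near. Qed.

(** * Finite-valued random variables *)

Section finite_valued.
Context (R : realType) (d : measure_display) (Omega : measurableType d)
  (P : probability Omega R) (I : finType) (W : Omega -> I).
Hypothesis mW : forall i, measurable (W @^-1` [set i]).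

Lemma measurable_finite_valued (g : I -> R) : measurable_fun setT (g \o W).
Proof.
move=> _ Y _; rewrite setTI.
rewrite (_ : _ @^-1` Y = \big[setU/set0]_(i <- index_enum I | `[< Y (g i) >]) (W @^-1` [set i])).
  exact: bigsetU_measurable.
rewrite -bigcup_seq_cond; apply/seteqP; split => [w Yw|w [i /=]].
  by exists (W w) => //=; rewrite mem_index_enum; apply/asboolP.
by move=> /andP[_ /asboolP Yi] ->.
Qed.

Lemma expectation_finite_valued (g : I -> R) :
  'E_P[g \o W]%E = (\sum_i fine (P (W @^-1` [set i])) * g i)%:E.
Proof.
have cover : setT = \big[setU/set0]_(i <- index_enum I) (W @^-1` [set i]).
  rewrite -bigcup_seq; apply/seteqP; split => // w _.
  by exists (W w) => //=; rewrite mem_index_enum.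
rewrite unlock /= cover integral_bigsetU_EFin ?index_enum_uniq//.
- rewrite -sumEFin; apply: eq_bigr => i _.
  rewrite (eq_integral (fun=> (g i)%:E)); last by move=> w; rewrite inE/= => ->.
  by rewrite integral_cst// muleC EFinM fineK// fin_num_measure.
- by move=> i j _ _ [w [/= <-]].
- by rewrite -cover; apply/measurable_EFinP; exact: measurable_finite_valued.
Qed.

(** The definition sums over distinct values, whereas [G] may repeat a value; the probability of a
    value is the sum of the probabilities of the indices that [G] sends to it. *)
Lemma simple_expectation_finite_valued (E : normedModType R) (G : I -> E) :
  simple_expectation P (G \o W) = \sum_i fine (P (W @^-1` [set i])) *: G i.
Proof.
pose s := undup [seq G i | i <- index_enum I].
have Gs i : G i \in s by rewrite mem_undup map_f// mem_index_enum.
rewrite /simple_expectation (@fsbig_widen _ _ _ _ _ [set` s]); first last.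
- move=> y [_ ny] /=; rewrite (_ : _ @^-1` _ = set0) ?measure0 ?scale0r//.
  by apply/seteqP; split => // w /= Gy; apply: ny; exists w.
- by move=> _ [w _ <-] /=.
rewrite -fsbig_seq ?undup_uniq//.
have PE y : fine (P ((G \o W) @^-1` [set y])) =
    \sum_i fine (P (W @^-1` [set i])) * (G i == y)%:R.
  have mGy : measurable ((G \o W) @^-1` [set y]).
    rewrite (_ : _ @^-1` _ = (fun w => (G (W w) == y)%:R) @^-1` [set 1 : R]).
      by rewrite -[X in measurable X]setTI; apply: (measurable_finite_valued (fun i => (G i == y)%:R)).
    apply/seteqP; split => w /= => [->|]; first by rewrite eqxx.
    by case: eqP => // _ /eqP; rewrite eq_sym oner_eq0.
  rewrite -(expectation_indic P mGy).
  rewrite (_ : \1__ = (fun i => (G i == y)%:R) \o W) ?expectation_finite_valued//.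
  apply/funext => w; rewrite indicE /=; congr ((nat_of_bool _)%:R).
  by apply/idP/eqP => [|Gy]; rewrite ?inE.
under eq_bigr do rewrite PE scaler_suml.
rewrite exchange_big/=; apply: eq_bigr => i _.
rewrite (bigD1_seq (G i)) ?undup_uniq//= eqxx mulr1 big1 ?addr0// => y yi.
by rewrite eq_sym (negbTE yi) mulr0 scale0r.
Qed.

End finite_valued.

(** Replacing [g] by 0 on the null set [N] keeps its integral and makes the comparison with [f] hold
    everywhere. *)
Lemma expectation_le_outside (R : realType) (d : measure_display)
    (Omega : measurableType d) (P : probability Omega R) (f g : Omega -> R)
    (N : set Omega) :
  measurable N -> P N = 0%E -> (forall w, 0 <= f w) ->
  measurable_fun setT g -> (forall w, ~ N w -> g w <= f w) ->
  ('E_P[g] <= 'E_P[f])%E.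
Proof.
move=> mN N0 f0 mg gf; rewrite !unlock.
rewrite (@ae_eq_integral _ _ _ P setT ((EFin \o g) \_ (~` N)) (EFin \o g))//.
- apply: le_integral_pointwise => w _; rewrite /patch.
  by case: ifPn => [|_]; [rewrite inE lee_fin => /gf|rewrite lee_fin].
- exact/measurable_EFinP.
- apply/(measurable_restrictT _ (measurableC mN)).1/measurable_EFinP.
  exact: measurable_funS mg.
- exists N; split => // w /=; apply: contra_notP => nN _.
  by rewrite /patch ifT// inE.
Qed.

(** * Random signs and their standardization *)

Lemma measurable_eq1 (R : realType) (b : bool) :
  measurable [set t : R | (t == 1) = b].
Proof.
case: b.
  rewrite (_ : [set _ | _] = [set 1])//.
  by apply/seteqP; split => t /= /eqP.
rewrite (_ : [set _ | _] = ~` [set 1]); first exact: measurableC.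
by apply/seteqP; split => t /=; [move/negbT/eqP|move/eqP/negbTE].
Qed.

Section random_sign.
Context (R : realType) (d : measure_display) (Omega : measurableType d)
  (P : probability Omega R) (xi : {RV P >-> R}) (a : R).
Hypothesis xi1 : P [set w | xi w = 1] = (1 - a)%:E.
Hypothesis xiN1 : P [set w | xi w = - 1] = a%:E.

Let m1 (r : R) : measurable [set w | xi w = r].
Proof.
rewrite -[X in measurable X]setTI.
exact: (@measurable_funPT _ _ _ _ xi measurableT _ (measurable_set1 r)).
Qed.

Lemma sign_null : P [set w | xi w != 1 /\ xi w != - 1] = 0%E.
Proof.
rewrite (_ : [set _ | _] = ~` ([set w | xi w = 1] `|` [set w | xi w = - 1])).
  rewrite probability_setC; last exact: measurableU.
  rewrite measureU//.
    rewrite [X in (1 - X)%E](_ : _ = ((1 - a)%:E + a%:E)%E); last by congr (_ + _)%E.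
    by rewrite -EFinD subrK subrr.
  by apply/seteqP; split => // w /= [->] /eqP; rewrite eq_sym eqNr oner_eq0.
apply/seteqP; split => w /=.
  by move=> [/eqP h1 /eqP h2] [].
by move=> h; split; apply/eqP => h'; apply: h; [left|right].
Qed.

Lemma measurable_sign_null : measurable [set w | xi w != 1 /\ xi w != - 1].
Proof.
rewrite (_ : [set _ | _] = ~` ([set w | xi w = 1] `|` [set w | xi w = - 1])).
  by apply: measurableC; exact: measurableU.
apply/seteqP; split => w /=.
  by move=> [/eqP h1 /eqP h2] [].
by move=> h; split; apply/eqP => h'; apply: h; [left|right].
Qed.

Lemma measurable_sign_bool (b : bool) : measurable [set w | (xi w == 1) = b].
Proof.
case: b.
  by rewrite (_ : [set _ | _] = [set w | xi w = 1])//; apply/seteqP; split => w /= /eqP.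
rewrite (_ : [set _ | _] = ~` [set w | xi w = 1]); first exact: measurableC.
by apply/seteqP; split => w /=; [move/negbT/eqP|move/eqP/negbTE].
Qed.

Lemma sign_bool_weight (b : bool) :
  P [set w | (xi w == 1) = b] = (bool_weight a b)%:E.
Proof.
case: b.
  rewrite -xi1; congr (P _); by apply/seteqP; split => w /= /eqP.
rewrite (_ : [set _ | _] = ~` [set w | xi w = 1]).
  by rewrite probability_setC// xi1 -EFinB /= opprB addrC subrK.
by apply/seteqP; split => w /=; [move/negbT/eqP|move/eqP/negbTE].
Qed.

(** Almost surely [xi] is 1 or -1, so [h \o xi] agrees off a null set with a function of the boolean
    [xi w == 1], whose law is known. *)
Lemma sign_expectation (h : R -> R) : measurable_fun setT h ->
  'E_P[h \o xi]%E = ((1 - a) * h 1 + a * h (- 1))%:E.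
Proof.
move=> mh.
pose g (b : bool) := h (if b then 1 else - 1).
pose b w := xi w == 1.
have mb i : measurable (b @^-1` [set i]) by exact: measurable_sign_bool.
transitivity ('E_P[g \o b])%E; last first.
  by rewrite expectation_finite_valued// big_bool/= !sign_bool_weight.
rewrite unlock; apply: ae_eq_integral => //.
- by apply/measurable_EFinP; exact: measurableT_comp.
- by apply/measurable_EFinP; exact: measurable_finite_valued.
- exists [set w | xi w != 1 /\ xi w != - 1].
  split; [exact: measurable_sign_null|exact: sign_null|].
  move=> w /=; apply: contra_notP => /not_andP nw _.
  rewrite /g /b; case: (eqVneq (xi w) 1) nw => [->//|x1 [//|/negP]].
  by rewrite negbK => /eqP ->.
Qed.

Lemma standardize_sign w :
  standardize P xi w = (xi w - (1 - 2 * a)) / Num.sqrt (4 * (a * (1 - a))).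
Proof.
have Exi : 'E_P[xi]%E = (1 - 2 * a)%:E.
  by rewrite (sign_expectation (h := id))//; congr EFin; ring.
rewrite /standardize Exi/=; congr (_ / Num.sqrt _).
rewrite /variance unlock Exi/=.
pose h (x : R) := (x - (1 - 2 * a)) ^+ 2.
transitivity (fine 'E_P[h \o xi]%E) => //.
rewrite sign_expectation/= /h; first ring.
apply: measurable_funX; exact: measurable_funB.
Qed.

End random_sign.

Lemma bool_stdE (R : realType) (a : R) (b : bool) : 0 < a < 1 ->
  bool_std a b =
    ((if b then 1 else - 1) - (1 - 2 * a)) / Num.sqrt (4 * (a * (1 - a))).
Proof.
move=> /andP[a0 a1].
have a1' : 1 - a != 0 by rewrite subr_eq0 gt_eqF.
have a0' : a != 0 by rewrite gt_eqF.
have u0 : 0 < a * (1 - a) by rewrite mulr_gt0// subr_gt0.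
have s0 : Num.sqrt (a * (1 - a)) != 0 by rewrite gt_eqF// sqrtr_gt0.
have sE := sqr_sqrtr (ltW u0).
rewrite sqrtrM// (_ : 4 = 2 ^+ 2); last by ring.
rewrite sqrtr_sqr ger0_norm// /bool_std.
set s := Num.sqrt _ in s0 sE *.
(* Multiplying by the nonzero root [s] leaves a rational identity in [a]. *)
apply: (mulfI s0); rewrite mulrA -expr2 sE.
by case: b; field; rewrite ?s0 ?a0' ?a1'.
Qed.

(** * Finite coding of the variables and their joint law *)

(** Fibers of the coded vectors are such intersections; this is what lets [independent_vectors]
    apply to them. *)
Lemma g_sigma_preimage_bigcap (d d' : measure_display)
    (Omega : measurableType d) (T : measurableType d') (n : nat)
    (X : 'I_n -> Omega -> T) (A : 'I_n -> set T) (J : {set 'I_n}) :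
  (forall i, measurable (A i)) ->
  g_sigma_preimage X (\bigcap_(i in [set` J]) X i @^-1` A i).
Proof.
move=> mA.
apply: (@fin_bigcap_measurable _ (g_sigma_algebraType
  (\big[setU/set0]_(i < n) preimage_set_system setT (X i) measurable))) => //.
move=> i _; apply: sub_sigma_algebra; rewrite -bigcup_seq.
exists i => //=; first by rewrite mem_index_enum.
by exists (A i) => //; rewrite setTI.
Qed.

(** A single finite type codes the values of all the variables, so that vectors become finite
    functions and expectations finite sums. Injectivity of [v] identifies the fibers of the codes
    with those of the variables. *)
Lemma finite_ranges_factor (Omega : Type) (T : choiceType) (n : nat)
    (X : 'I_n -> Omega -> T) : (forall i, finite_set (range (X i))) ->
  exists (V : finType) (v : V -> T) (k : 'I_n -> Omega -> V),
    injective v /\ forall i w, X i w = v (k i w).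
Proof.
move=> fX.
have /finite_seqP[s sE] : finite_set (\bigcup_(i in [set: 'I_n]) range (X i)).
  by apply: bigcup_finite => //; exact: finite_finset.
have Xs i w : X i w \in s.
  have : (\bigcup_(i in [set: 'I_n]) range (X i)) (X i w) by exists i => //; exists w.
  by rewrite sE.
exists (seq_sub s), (@ssval _ s), (fun i w => SeqSub (Xs i w)); split => //.
exact: val_inj.
Qed.

Section joint_law.
Context (R : realType) (d d' : measure_display) (Omega : measurableType d)
  (T : measurableType d') (P : probability Omega R) (n : nat)
  (X : 'I_n -> {RV P >-> T}) (V : finType) (v : V -> T) (k : 'I_n -> Omega -> V).
Hypothesis m1 : forall t : T, measurable [set t].
Hypothesis v_inj : injective v.
Hypothesis Xv : forall i w, X i w = v (k i w).
Hypothesis Xindep : mutually_independent P X.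

Definition value_weight (i : 'I_n) (c : V) : R := fine (P (X i @^-1` [set v c])).
Definition code (w : Omega) : {ffun 'I_n -> V} := [ffun i => k i w].

Let mX i t : measurable (X i @^-1` [set t]).
Proof.
rewrite -[X in measurable X]setTI.
exact: (@measurable_funPT _ _ _ _ (X i) measurableT _ (m1 t)).
Qed.

Let kE i c : k i @^-1` [set c] = X i @^-1` [set v c].
Proof.
by apply/seteqP; split => w /=; rewrite Xv; [move=> ->|move/v_inj].
Qed.

Lemma code_fiber (x : {ffun 'I_n -> V}) : code @^-1` [set x] =
  \bigcap_(i in [set` (finset.setT : {set 'I_n})]) X i @^-1` [set v (x i)].
Proof.
apply/seteqP; split => w /=; first by move=> <- i _ /=; rewrite Xv ffunE.
move=> h; apply/ffunP => i; rewrite ffunE; apply: v_inj.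
by rewrite -Xv; apply: h; rewrite /= finset.in_setT.
Qed.

Lemma measurable_code x : measurable (code @^-1` [set x]).
Proof. by rewrite code_fiber; apply: fin_bigcap_measurable => //. Qed.

Lemma code_law x : P (code @^-1` [set x]) = (prod_weight value_weight x)%:E.
Proof.
rewrite code_fiber Xindep// -prodEFin.
rewrite (eq_bigl xpredT); last by move=> i; rewrite finset.in_setT.
by apply: eq_bigr => i _; rewrite fineK// fin_num_measure.
Qed.

Lemma value_weight_ge0 i c : 0 <= value_weight i c.
Proof. exact/fine_ge0. Qed.

Lemma value_weight_sum1 i : \sum_c value_weight i c = 1.
Proof.
have := @expectation_finite_valued _ _ _ P _ (k i) _ (cst 1).
rewrite (_ : cst 1 \o k i = cst 1)// expectation_cst => /(_ _)/wrap[].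
  by move=> c; rewrite kE.
by move=> [->]; apply: eq_bigr => c _; rewrite mulr1 kE.
Qed.

End joint_law.

(** * Integration of the supporting lower bound along the interpolation *)

Lemma convex_functionT_convexf (R : realType) (E : lmodType R) (p : E -> R) :
  convex_function [set: convex_lmodType E] p -> convexf p.
Proof.
move=> cp t x y /andP[t0 t1].
exact: (cp (Itv01 t0 t1) x y (in_setT x) (in_setT y)).
Qed.

Theorem theorem2p1 (R : realType) (E : completeNormedModType R)
    (Phi : E -> R)
    (Phi_ge0 : forall u : E, 0 <= Phi u)
    (Phi_continuous : continuous Phi)
    (Phi_convex : convex_function [set: convex_lmodType E] Phi)
    (d : measure_display) (Omega : measurableType d) (P : probability Omega R)
    (d' : measure_display) (T : measurableType d')
    (measurable_singleton : forall t : T, measurable [set t])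
    (n : nat) (X : 'I_n -> {dRV P >-> T})
    (X_finite : forall i, finite_set (range (X i)))
    (X_iid : iid P X)
    (S : ('I_n -> T) -> E)
    (xi : R -> 'I_n -> {RV P >-> R})
    (xi_iid : forall alpha : R, 0 < alpha < 1 -> iid P (xi alpha))
    (xi_indep_X : forall alpha : R, 0 < alpha < 1 ->
      independent_vectors P (xi alpha) X)
    (xi_eq1 : forall (alpha : R) i, 0 < alpha < 1 ->
      P [set w | xi alpha i w = 1] = (1 - alpha)%:E)
    (xi_eqN1 : forall (alpha : R) i, 0 < alpha < 1 ->
      P [set w | xi alpha i w = - 1] = alpha%:E) :
  ('E_P[fun w => (Phi (S (fun j => X j w) -
          simple_expectation P (fun w' => S (fun j => X j w'))))%R] <=
   \int[lebesgue_measure]_(alpha in `]0%R, 1%R[)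
     ('E_P[fun w => (Phi (pi *: \sum_(i < n)
              standardize P (xi alpha i) w *:
              centered_diff P X S i (fun j => X j w)))%R]
      * ((pi * Num.sqrt (alpha * (1 - alpha)))^-1)%:E))%E.
Proof.
have [V [v [k [v_inj Xv]]]] := finite_ranges_factor X_finite.
pose W := code k.
pose X' i : {RV P >-> T} := X i.
have Xv' i w : X' i w = v (k i w) by exact: Xv.
pose p := value_weight X' v.
pose pr x := prod_weight p x.
have p1 : forall i, \sum_c p i c = 1 := value_weight_sum1 measurable_singleton v_inj Xv'.
have p0 : forall i c, 0 <= p i c by move=> i c; exact: value_weight_ge0.
have mW x : measurable (W @^-1` [set x]).
  exact: (measurable_code measurable_singleton v_inj Xv').
have PW : forall x, P (W @^-1` [set x]) = (pr x)%:E :=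
  code_law measurable_singleton v_inj Xv' X_iid.1.
pose S' (x : {ffun 'I_n -> V}) := S (fun j => v (x j)).
pose H i (x : {ffun 'I_n -> V}) :=
  simple_expectation P (fun w => S (fun j => if j == i then X i w else v (x j))).
have XW w : (fun j => X j w) = (fun j => v (W w j)).
  by apply/funext => j; rewrite Xv ffunE.
have Hi i (x y : {ffun 'I_n -> V}) : (forall j, j != i -> x j = y j) -> H i x = H i y.
  move=> xy; congr simple_expectation; apply/funext => w; congr S.
  by apply/funext => j; case: eqP => // /eqP /xy ->.
have ESE : simple_expectation P (fun w => S (fun j => X j w)) = \sum_x pr x *: S' x.
  rewrite (_ : (fun w => _) = S' \o W); last by apply/funext => w; rewrite XW.
  by rewrite simple_expectation_finite_valued//; under eq_bigr do rewrite PW.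
set ES := simple_expectation _ _ in ESE *.
have -> : 'E_P[fun w => Phi (S (fun j => X j w) - ES)%R]%E =
    (\sum_x pr x * Phi (S' x - ES))%:E.
  rewrite (_ : (fun w => _) = (fun x => Phi (S' x - ES)) \o W); last first.
    by apply/funext => w; rewrite XW.
  by rewrite expectation_finite_valued//; under eq_bigr do rewrite PW.
have cPhi := convex_functionT_convexf Phi_convex.
(* The affine function [c x + l x u] of [u] lies below [Phi] and touches it at [S' x - ES]. *)
pose l x := sval (cid (convexf_subgradient (S' x - ES) cPhi)).
pose c x := Phi (S' x - ES) - l x (S' x - ES).
have lPhi x u : c x + l x u <= Phi u.
  have := svalP (cid (convexf_subgradient (S' x - ES) cPhi)) u.
  by rewrite -/(l x) linearB/= /c; lra.
(* The mean of [l x] applied to [S] at the resampled point, for a fixed pattern [e] of kept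
   coordinates; [B a] below averages it over the signs. *)
pose r e := \sum_x pr x * \sum_y pr y * l x (S' (mix e x y)).
pose qr a := @prod_weight R n bool (fun=> bool_weight a).
pose C := \sum_x pr x * c x.
(* The lower bound of [weighted_convex_ge], regrouped by signs; [g] multiplies it by the arcsine
   density. *)
pose G a := C + pi * \sum_e qr a e * ((\sum_i bool_std a (e i)) * r e).
pose g a := G a * (pi * Num.sqrt (a * (1 - a)))^-1.
pose B a := \sum_e qr a e * r e.
have pi0 : pi != 0 :> R by rewrite gt_eqF// pi_gt0.
have sum_pr : \sum_x pr x = 1 by exact: prod_weight_sum1.
(* At the touching point [Phi] equals [c x + l x (S' x - ES)]. The linear part has mean [B 0 - B 1],
   because nothing is resampled at 0 and everything at 1. *)
have -> : \sum_x pr x * Phi (S' x - ES) = C / pi * pi - (B 1 - B 0).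
  rewrite divfK//.
  have -> : B 1 = \sum_x pr x * l x ES.
    rewrite /B /qr (sum_bool_degenerate r false); apply: eq_bigr => x _.
    congr (_ * _); rewrite ESE linear_sum; apply: eq_bigr => y _.
    rewrite linearZ; congr (_ * l x (S' _)).
    by apply/ffunP => i; rewrite !ffunE.
  have -> : B 0 = \sum_x pr x * l x (S' x).
    rewrite /B /qr (sum_bool_degenerate r true); apply: eq_bigr => x _.
    congr (_ * _); rewrite (eq_bigr (fun y => pr y * l x (S' x))).
      by rewrite -mulr_suml sum_pr mul1r.
    move=> y _; congr (_ * l x (S' _)).
    by apply/ffunP => i; rewrite !ffunE.
  rewrite /C -!sumrB; apply: eq_bigr => x _; rewrite /c linearB/=; ring.
apply: (@arcsine_FTC_le _ _ _ g).
- move=> a; apply: continuous_sum_weight => e; exact: cvg_cst.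
(* The derivative of [acos (1 - 2 * a)] is the inverse of [Num.sqrt (a * (1 - a))]; the score in
   [is_derive_sum_bool] gives the other term of [g]. *)
- move=> a a01; have /andP[a0 a1] := a01.
  have s0 : 0 < Num.sqrt (a * (1 - a)) by rewrite sqrtr_gt0 mulr_gt0// subr_gt0.
  have dlin : is_derive a 1 (fun a : R => 1 - 2 * a) (- 2).
    by apply: is_derive_eq; rewrite /GRing.scale/=; ring.
  have dac : is_derive a 1 (fun a : R => acos (1 - 2 * a))
      (Num.sqrt (a * (1 - a)))^-1.
    have a11 : -1 < 1 - 2 * a < 1 by apply/andP; split; lra.
    have dc := is_derive1_comp (is_derive1_acos a11 : is_derive ((fun a => 1 - 2 * a) a) _ _ _) dlin.
    apply: (is_derive_eq dc).
    rewrite (_ : 1 - (1 - 2 * a) ^+ 2 = 2 ^+ 2 * (a * (1 - a))); last by ring.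
    rewrite sqrtrM ?sqr_ge0// sqrtr_sqr ger0_norm//; field.
    by rewrite gt_eqF.
  apply: (is_derive_eq (is_deriveB (is_deriveM (is_derive_cst (C / pi) a 1) dac)
    (is_derive_sum_bool r a01))).
  rewrite /g /G /GRing.scale/= -/qr; move: pi pi0 => q q0; field.
  by rewrite q0 gt_eqF.
- move=> a a01; have /andP[a0 a1] := a01.
  apply: cvgM.
    apply: cvgD; first exact: cvg_cst.
    apply: cvgM; first exact: cvg_cst.
    apply: continuous_sum_weight => e; apply: cvgM; last exact: cvg_cst.
    apply: cvg_big => [|i _]; first exact: add_continuous.
    exact: continuous_bool_std.
  apply: cvgV.
    by rewrite mulf_neq0// gt_eqF// sqrtr_gt0 mulr_gt0// subr_gt0.
  apply: cvgM; first exact: cvg_cst.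
  exact: continuous_sqrt_var.
- move=> a a01; apply: mule_ge0; first by apply: expectation_ge0.
  by rewrite lee_fin invr_ge0 mulr_ge0 ?sqrtr_ge0// pi_ge0.
move=> a a01; rewrite /g EFinM; apply: lee_wpmul2r.
  by rewrite lee_fin invr_ge0 mulr_ge0 ?sqrtr_ge0// pi_ge0.
(* Every value other than 1 is coded as -1; the values other than 1 and -1 are discarded below
   through the null set [N]. *)
pose b i w := xi a i w == 1.
pose U w : {ffun 'I_n -> bool} := [ffun i => b i w].
pose UW w := (U w, W w).
have UE e : U @^-1` [set e] = \bigcap_(i in [set` (finset.setT : {set 'I_n})])
    xi a i @^-1` [set t | (t == 1) = e i].
  apply/seteqP; split => w /=; first by move=> <- i _ /=; rewrite ffunE.
  by move=> h; apply/ffunP => i; rewrite ffunE; apply: h; rewrite /= finset.in_setT.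
have mb i e : measurable (xi a i @^-1` [set t | (t == 1) = e]) by exact: measurable_sign_bool.
have mt := @measurable_eq1 R.
have UWE u : UW @^-1` [set u] = U @^-1` [set u.1] `&` W @^-1` [set u.2].
  by case: u => e x; apply/seteqP; split => w /= => [[<- <-]|[<- <-]].
have mUW u : measurable (UW @^-1` [set u]).
  rewrite UWE; apply: measurableI => //.
  by rewrite UE; apply: fin_bigcap_measurable.
have PUW u : P (UW @^-1` [set u]) = (qr a u.1 * pr u.2)%:E.
  rewrite UWE EFinM -PW (xi_indep_X a a01); last first.
  - by rewrite (code_fiber v_inj Xv'); apply: g_sigma_preimage_bigcap.
  - by rewrite UE; apply: g_sigma_preimage_bigcap.
  congr (_ * _)%E; rewrite UE (xi_iid a a01).1// /qr /prod_weight -prodEFin.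
  rewrite (eq_bigl xpredT); last by move=> i; rewrite finset.in_setT.
  by apply: eq_bigr => i _; exact: (sign_bool_weight (xi_eq1 a i a01)).
pose F (u : {ffun 'I_n -> bool} * {ffun 'I_n -> V}) :=
  Phi (pi *: \sum_i bool_std a (u.1 i) *: (S' u.2 - H i u.2)).
(* [F \o UW] takes finitely many values and equals the integrand of the theorem outside [N]. *)
apply: (@le_trans _ _ ('E_P[F \o UW])%E).
  rewrite expectation_finite_valued// lee_fin.
  under [leRHS]eq_bigr do rewrite PUW/= -mulrA.
  rewrite -(pair_bigA _ (fun e x => qr a e * (pr x * F (e, x))))/=.
  under [leRHS]eq_bigr do rewrite -mulr_sumr.
  apply: le_trans (weighted_convex_ge p1 p0 S' lPhi Hi a01).
  rewrite /G /C; under [leRHS]eq_bigr do rewrite mulrDr.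
  rewrite big_split/= lerD2l le_eqVlt; apply/orP; left; apply/eqP.
  under [RHS]eq_bigr do rewrite mulrCA.
  rewrite -mulr_sumr; congr (_ * _).
  under [RHS]eq_bigr do rewrite mulr_sumr.
  rewrite [RHS]exchange_big/=; apply: eq_bigr => e _.
  rewrite /r !mulr_sumr; apply: eq_bigr => x _.
  rewrite /pr /qr; ring.
pose Ni i := [set w | xi a i w != 1 /\ xi a i w != - 1].
pose N := \bigcup_(i in [set: 'I_n]) Ni i.
have mNi i : measurable (Ni i) by exact: measurable_sign_null.
have mN : measurable N by apply: fin_bigcup_measurable => //; exact: finite_finset.
apply: (@expectation_le_outside _ _ _ _ _ _ N) => //.
- apply/negligibleP => //.
  (* The finite union is reindexed by the natural numbers, with empty sets from [n] on, to use that
     a countable union of negligible sets is negligible. *)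
  pose NN := \bigcup_m (if insub m is Some i then Ni i else set0).
  apply: (@negligibleS _ _ _ _ NN).
    by move=> w [i _ Niw]; exists (val i) => //; rewrite valK.
  apply: negligible_bigcup => m; case: insub => [i|]; last exact: negligible_set0.
  by apply/negligibleP => //; apply: sign_null; [exact: xi_eq1|exact: xi_eqN1].
- exact: measurable_finite_valued.
- move=> w Nw; rewrite /F /=.
  rewrite le_eqVlt; apply/orP; left; apply/eqP; congr (Phi (_ *: _)).
  apply: eq_bigr => i _.
  rewrite (standardize_sign (xi_eq1 a i a01) (xi_eqN1 a i a01)) bool_stdE// ffunE.
  rewrite /centered_diff XW; congr ((_ - _) / _ *: _).
  rewrite /b; case: (eqVneq (xi a i w) 1) => [->//|x1].
    by apply/eqP; apply: contra_notT Nw => x2; exists i => //; split; rewrite // eq_sym.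
  rewrite /H; congr (_ - simple_expectation _ _); apply/funext => w'; congr S.
  by apply/funext => j; case: eqP => // _; rewrite Xv ffunE.
Qed.
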